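(* For all integers $n,m,k\geq 0$, $$\sum_{j=0}^{m}s(m,j)A_{n+k+j,k+j}=\sum_{i=0}^{k}\sum_{r=0}^{n}\binom{k}{i}\binom{n}{r}m^{n+k-i-r}A_{r+i,i},$$ $$\sum_{j=0}^{m}s(m,j)A_{n+k+j,k+j}=\sum_{i=0}^{k}\sum_{r=0}^{n}\binom{k}{i}\binom{n}{r}m^{k-i}(m-1)^{n-r}B_{r+i},$$ $$\sum_{j=0}^{m}s(m,j)A_{n+k+j+1,n+1}=\sum_{i=0}^{k}\sum_{r=0}^{n}\binom{k}{i}\binom{n}{r}m^{k-i}(m+1)^{n-r}B_{r+i}.$$
   Context: $s(m,j)$ are the (signed) Stirling numbers of the first kind, defined by $x(x-1)\cdots(x-m+1)=\sum_{j=0}^{m}s(m,j)x^j$. A partition of a finite set is a collection of nonempty, pairwise disjoint subsets (blocks) whose union is the set; a singleton of a partition is a block with exactly one element. $B_n$ denotes the $n$-th Bell number ($B_0=1$). For integers $0\leq k\leq n$, $A_{n,k}$ denotes the number of partitions of $\{1,2,\dots,n+1\}$ whose largest singleton is $k+1$ (i.e. $\{k+1\}$ is a block and no $j>k+1$ forms a singleton block). The convention $0^0=1$ is used. *)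

(* Defs.v *)
From HB Require Import structures.
From mathcomp Require Import all_boot all_order all_algebra.
Set Implicit Arguments.
Unset Strict Implicit.
Unset Printing Implicit Defensive.
Import GRing.Theory.
Local Open Scope ring_scope.

Definition stirling1 (m j : nat) : int :=
  (\prod_(i < m) ('X - (i%:Z)%:P) : {poly int})`_j.

Definition bell (n : nat) : nat :=
  #|[set P : {set {set 'I_n}} | partition P [set: 'I_n]]|.

Definition largest_singleton (N : nat) (P : {set {set 'I_N}}) (i : 'I_N) : bool :=
  ([set i] \in P) && [forall j : 'I_N, (i < j)%N ==> ([set j] \notin P)].

(* The set {1, ..., n+1} is represented by 'I_n.+1 through x |-> x - 1, so the
   element k+1 is the ordinal of value k. The value is 0 when k > n. *)
Definition A (n k : nat) : nat :=
  #|[set P : {set {set 'I_n.+1}} | partition P [set: 'I_n.+1] &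
      [exists i : 'I_n.+1, (val i == k) && largest_singleton P i]]|.

(* Main.v *)
(** The proof is umbral. Let [L] be the linear functional on integer polynomials
    with [L (X^n)] the [n]-th Bell number. The Bell recurrence says
    [L (X * p) = L (p (X + 1))], hence [L ((X)_m * p) = L (p (X + m))] for the
    falling factorial [(X)_m]. Inclusion-exclusion on the elements that must not
    be singletons gives [A_(a+b, a) = L (X^a (X - 1)^b)]. The left-hand sides are
    therefore values of [L] at multiples of a falling factorial, and the
    identities are binomial expansions of the shifted polynomials. *)

Require Import Defs.
From HB Require Import structures.
From mathcomp Require Import all_boot all_order all_algebra.
From mathcomp Require Import ring zify.
Import GRing.Theory.
Local Open Scope ring_scope.

(** * Counting partitions *)

(** Deleting the block [X] is a bijection with inverse [X |: _]: a nonempty [X] cannot be a block of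
    a partition of [S :\: X]. The predicate [Q] will carry conditions on singletons. *)
Lemma card_partition_block (T : finType) (S X : {set T})
    (Q : pred {set {set T}}) : X \subset S -> X != set0 ->
  #|[set P | partition P S & (X \in P) && Q (P :\ X)]| =
  #|[set P | partition P (S :\: X) & Q P]|.
Proof.
move=> sXS X0.
have XnP P : partition P (S :\: X) -> X \notin P.
  move=> partP; apply/negP => XP; case/set0Pn: X0 => x xX.
  by have /subsetP/(_ x xX) := partitionS partP XP; rewrite inE xX.
rewrite -[RHS](@card_in_imset _ _ (fun P => X |: P)); last first.
  move=> P1 P2; rewrite !inE => /andP[/XnP n1 _] /andP[/XnP n2 _] eqP12.
  by rewrite -(setU1K n1) eqP12 setU1K.
apply: eq_card => P; apply/idP/imsetP => [|[P' + ->]]; rewrite !inE.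
  case/and3P=> partP XP QP; exists (P :\ X); last by rewrite setD1K.
  by rewrite inE QP (partitionD1 partP XP).
move=> /andP[partP QP]; rewrite eqxx (setU1K (XnP _ partP)) QP !andbT.
have disX : [disjoint X & S :\: X] by rewrite -setI_eq0 setDE setICA setICr setI0.
have := partitionU1 partP X0 disX.
by rewrite setDE setUIr setUCr setIT (setUidPr sXS).
Qed.

(** Partitions are sorted by the complement [Y] of the block of [e]; the other blocks partition
    [Y]. *)
Lemma card_partitions_rec (T : finType) (S : {set T}) (e : T) : e \in S ->
  #|[set P | partition P S]| =
  (\sum_(Y in powerset (S :\ e)) #|[set P | partition P Y]|)%N.
Proof.
move=> eS.
rewrite -sum1_card (partition_big (fun P => S :\: pblock P e)
  (mem (powerset (S :\ e)))) /=; last first.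
  move=> P; rewrite !inE => partP; apply: setDS; rewrite sub1set.
  by rewrite mem_pblock (cover_partition partP).
apply: eq_bigr => Y; rewrite inE subsetD1 => /andP[sYS eY].
have eX : e \in S :\: Y by rewrite inE eY.
have -> : Y = S :\: (S :\: Y) by rewrite setDDr setDv set0U (setIidPr sYS).
have X0 : S :\: Y != set0 by apply/set0Pn; exists e.
have /= := card_partition_block T S (S :\: Y) xpredT (subsetDl _ _) X0.
rewrite [X in _ = X -> _](_ : _ = #|[set P | partition P (S :\: (S :\: Y))]|).
  move=> <-; rewrite sum1_card; apply: eq_card => P; rewrite !inE unfold_in /=.
  rewrite inE; case partP: (partition P S) => //=.
  rewrite andbT setDDr setDv set0U (setIidPr sYS).
  have covP := cover_partition partP; have tiP := partition_trivIset partP.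
  apply/eqP/idP => [<-|XP].
    have eP : e \in cover P by rewrite covP.
    have /setIidPr sB : pblock P e \subset S.
      by apply: (partitionS partP); rewrite pblock_mem.
    by rewrite setDDr setDv set0U sB pblock_mem.
  by rewrite (def_pblock tiP XP eX) setDDr setDv set0U (setIidPr sYS).
by apply: eq_card => P; rewrite !inE andbT.
Qed.

Lemma sum_powerset_card (T : finType) (S : {set T}) (F : nat -> nat) :
  (\sum_(Y in powerset S) F #|Y| = \sum_(i < #|S|.+1) 'C(#|S|, i) * F i)%N.
Proof.
rewrite (partition_big (fun Y : {set T} => inord #|Y| : 'I_#|S|.+1) xpredT) //=.
apply: eq_bigr => i _; rewrite -cards_draws -sum_nat_const.
(* [inord] is faithful here because [Y \subset S] keeps the size in range. *)
have sub (Y : {set T}) : Y \subset S -> (inord #|Y| == i) = (#|Y| == i).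
  by move=> /subset_leq_card leYS; rewrite -val_eqE /= inordK.
rewrite [RHS](eq_bigl (fun Y : {set T} => (Y \in powerset S) && (inord #|Y| == i))).
  by apply: eq_bigr => Y /andP[]; rewrite inE => /sub-> /eqP->.
by move=> Y; rewrite !inE; case sYS: (Y \subset S); rewrite //= sub.
Qed.

Lemma card_partitions (T : finType) (S : {set T}) :
  #|[set P | partition P S]| = bell #|S|.
Proof.
move: {2}_.+1 (ltnSn #|S|) => N; elim: N T S => // N IHN T S.
(* Applied to [S] and to the ordinals that define [bell], so both counts reduce to the same sum;
   hence the induction over all finite types. *)
have rec (T' : finType) (S' : {set T'}) n : #|S'| = n.+1 -> (n < N)%N ->
    #|[set P | partition P S']| = (\sum_(i < n.+1) 'C(n, i) * bell i)%N.
  move=> cS lnN; have /card_gt0P[e eS] : (0 < #|S'|)%N by rewrite cS.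
  have cSe : #|S' :\ e| = n by move: (cardsD1 e S'); rewrite cS eS => -[].
  rewrite (card_partitions_rec _ _ _ eS) -cSe -sum_powerset_card.
  apply: eq_bigr => Y; rewrite inE => /subset_leq_card; rewrite cSe => leY.
  by apply: IHN; apply: leq_ltn_trans lnN.
case cS: #|S| => [|n] lnN; last first.
  rewrite (rec _ _ _ cS lnN) /bell; symmetry; apply: rec => //.
  by rewrite cardsT card_ord.
have I0 : [set: 'I_0] = set0 by apply/setP => -[].
have one (T' : finType) : #|[set P | partition P (set0 : {set T'})]| = 1%N.
  rewrite (_ : [set _ | _] = [set set0]) ?cards1 //.
  by apply/setP => P; rewrite !inE partition_set0.
by move/eqP: cS; rewrite cards_eq0 => /eqP ->; rewrite /bell I0 !one.
Qed.

Lemma bellS n : bell n.+1 = (\sum_(i < n.+1) 'C(n, i) * bell i)%N.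
Proof.
have cT : #|[set: 'I_n.+1]| = n.+1 by rewrite cardsT card_ord.
rewrite {1}/bell (card_partitions_rec _ _ _ (in_setT ord0)).
have cTe : #|[set: 'I_n.+1] :\ ord0| = n.
  by move: (cardsD1 ord0 [set: 'I_n.+1]); rewrite cT in_setT => -[].
rewrite -[in RHS]cTe -sum_powerset_card.
by apply: eq_bigr => Y _; exact: card_partitions.
Qed.

(** * The Bell functional *)

Definition bell_eval (p : {poly int}) : int :=
  \sum_(i < size p) p`_i * (bell i)%:Z.

Lemma bell_eval_widen N (p : {poly int}) : (size p <= N)%N ->
  bell_eval p = \sum_(i < N) p`_i * (bell i)%:Z.
Proof.
move=> lepN; rewrite /bell_eval (big_ord_widen _ (fun i => p`_i * (bell i)%:Z) lepN).
rewrite big_mkcond; apply: eq_bigr => i _.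
by case: ltnP => // /(nth_default 0) ->; rewrite mul0r.
Qed.

Lemma bell_eval_is_scalar : scalar bell_eval.
Proof.
move=> a p q; pose N := maxn (size (a *: p + q)) (maxn (size p) (size q)).
rewrite !(@bell_eval_widen N) ?leq_max ?leqnn ?orbT //.
rewrite mulr_sumr -big_split /=; apply: eq_bigr => i _.
by rewrite coefD coefZ mulrDl mulrA.
Qed.

HB.instance Definition _ :=
  GRing.isLinear.Build int {poly int} int *%R bell_eval bell_eval_is_scalar.

Lemma bell_evalXn n : bell_eval 'X^n = (bell n)%:Z.
Proof.
rewrite (@bell_eval_widen n.+1) ?size_polyXn // big_ord_recr /= big1 => [|i _].
  by rewrite coefXn eqxx mul1r add0r.
by rewrite coefXn ltn_eqF ?mul0r.
Qed.

(** By linearity only monomials matter, and for ['X^i] this is [bellS] read through the binomial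
    expansion of [('X + 1) ^+ i]. *)
Lemma bell_eval_mulX p : bell_eval ('X * p) = bell_eval (p \Po ('X + 1)).
Proof.
rewrite -[p]coefK poly_def mulr_sumr !linear_sum /=; apply: eq_bigr => i _.
rewrite -scalerAr comp_polyZ !linearZ /=; congr (_ * _).
rewrite -exprS bell_evalXn bellS comp_Xn_poly addrC exprDn linear_sum /=.
rewrite (big_morph _ PoszD (erefl _)); apply: eq_bigr => j _.
by rewrite expr1n mul1r raddfMn /= bell_evalXn PoszM -mulr_natl natz.
Qed.

Definition falling (m : nat) : {poly int} := \prod_(i < m) ('X - (i%:Z)%:P).

(** Induction on [m]: the shift by [m] turns the last factor ['X - m] into ['X], which
    [bell_eval_mulX] trades for one more unit of shift. *)
Lemma bell_eval_falling m p :
  bell_eval (falling m * p) = bell_eval (p \Po ('X + (m%:Z)%:P)).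
Proof.
elim: m p => [|m IHm] p; first by rewrite /falling big_ord0 mul1r addr0 comp_polyXr.
rewrite /falling big_ord_recr /= -mulrA IHm comp_polyM comp_polyB comp_polyX.
rewrite comp_polyC addrK bell_eval_mulX -comp_polyA comp_polyD comp_polyX comp_polyC.
by rewrite -addrA -polyC1 -polyCD -intS.
Qed.

(** The [stirling1 m j] are by definition the coefficients of [falling m], so the sum substitutes
    [q] into it. *)
Lemma sum_stirling1_bell_eval m (q g : {poly int}) :
  \sum_(0 <= j < m.+1) stirling1 m j * bell_eval (q ^+ j * g) =
  bell_eval ((falling m \Po q) * g).
Proof.
have sz : size (falling m) = m.+1.
  rewrite /falling -(big_mkord xpredT (fun i => 'X - (i%:Z)%:P)).
  by rewrite size_prod_XsubC size_iota subn0.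
rewrite comp_polyE sz mulr_suml linear_sum big_mkord /=; apply: eq_bigr => j _.
by rewrite -scalerAl linearZ.
Qed.

(** * Partitions without prescribed singletons *)

Definition no_singleton_in {T : finType} (U : {set T}) (P : {set {set T}}) : bool :=
  [forall u in U, [set u] \notin P].

(** Inclusion-exclusion, one element [e] of [U] at a time: lift the condition at [e], then subtract
    the partitions having [[set e]] as a block, which amount to partitions of [S :\ e]. *)
Lemma card_no_singleton_in (T : finType) (S U : {set T}) : U \subset S ->
  #|[set P | partition P S & no_singleton_in U P]|%:Z =
  bell_eval ('X^#|S :\: U| * ('X - 1) ^+ #|U|).
Proof.
move: {2}#|U| (erefl #|U|) => b; elim: b S U => [|b IHb] S U cU sUS.
  move/eqP: cU; rewrite cards_eq0 => /eqP ->.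
  rewrite setD0 cards0 mulr1 bell_evalXn -card_partitions; congr Posz.
  apply: eq_card => P; rewrite !inE; case: partition => //=.
  by apply/forall_inP => u; rewrite inE.
have /card_gt0P[e eU] : (0 < #|U|)%N by rewrite cU.
have eS : e \in S := subsetP sUS e eU.
have cUe : #|U :\ e| = b by move: (cardsD1 e U); rewrite cU eU => -[].
have sUeS : U :\ e \subset S by apply: subset_trans sUS; apply: subsetDl.
have sUeSe : U :\ e \subset S :\ e by apply: setSD.
have D1 : #|S :\: (U :\ e)| = #|S :\: U|.+1.
  have -> : S :\: (U :\ e) = e |: (S :\: U).
    apply/setP => x; rewrite !inE negb_and negbK andb_orl.
    by case: eqP => // ->; rewrite eS.
  by rewrite cardsU1 inE eU.
have D2 : (S :\ e) :\: (U :\ e) = S :\: U.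
  apply/setP => x; rewrite !inE negb_and negbK.
  by case: eqP => // ->; rewrite eU.
have N2 := IHb _ _ cUe sUeSe; have N1 := IHb _ _ cUe sUeS.
rewrite cU; move: N1 N2; rewrite D1 cUe D2 => N1 N2.
(* One factor ['X - 1] is split: ['X] counts [e] as a free element, [-1] removes [e] from [S]. *)
have -> : 'X^#|S :\: U| * ('X - 1) ^+ b.+1 =
    'X^(#|S :\: U|.+1) * ('X - 1) ^+ b - 'X^#|S :\: U| * ('X - 1) ^+ b :> {poly int}.
  by rewrite !exprS; ring.
rewrite linearB /= -N1 -N2; apply/eqP; rewrite eq_sym subr_eq -PoszD; apply/eqP.
congr Posz; rewrite -(cardsID [set P : {set {set T}} | [set e] \in P]) addnC.
congr addn.
  apply: eq_card => P; rewrite !inE andbC -andbA; congr andb.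
  apply/andP/forall_inP => [[/forall_inP nP eP] u uU|nP].
    by case: (eqVneq u e) => [->//|ue]; apply: nP; rewrite !inE ue.
  by split; [apply/forall_inP => u /setD1P[_ /nP] | exact: nP].
have e0 : [set e] != set0 by apply/set0Pn; exists e; rewrite set11.
rewrite -(@card_partition_block _ _ _ (no_singleton_in (U :\ e))) ?sub1set //.
apply: eq_card => P; rewrite !inE -andbA; congr andb; rewrite andbC; congr andb.
apply: eq_forallb_in => u /setD1P[ue _].
by rewrite !inE (inj_eq set1_inj) ue.
Qed.

(** Once the block [[set e]] of the largest singleton is deleted, the [a] elements below [e] are
    free and the [b] elements above it must not be singletons. *)
Lemma A_bell_eval a b : (A (b + a) a)%:Z = bell_eval ('X^a * ('X - 1) ^+ b).
Proof.
have lt_a : (a < (b + a).+1)%N by rewrite ltnS leq_addl.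
pose e := Ordinal lt_a; pose U := [set j : 'I_(b + a).+1 | (a < j)%N].
have cU : #|U| = b.
  rewrite -sum1_card (eq_bigl (fun j : 'I__ => true && (a < j)%N)) => [|j].
    rewrite -(big_geq_mkord _ _ xpredT (fun=> 1%N)).
    by rewrite sum_nat_const_nat muln1 subSS addnK.
  by rewrite inE.
have sU : U \subset [set: 'I_(b + a).+1] :\ e.
  apply/subsetP => j; rewrite !inE andbT => lt_aj.
  by apply: contraTneq lt_aj => ->; rewrite ltnn.
have cD : #|([set: 'I_(b + a).+1] :\ e) :\: U| = a.
  have cTe : #|[set: 'I_(b + a).+1] :\ e| = (b + a)%N.
    by move: (cardsD1 e setT); rewrite cardsT card_ord in_setT => -[].
  by rewrite cardsD (setIidPr sU) cU cTe addKn.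
rewrite -[in RHS]cU -[X in 'X^X]cD -(card_no_singleton_in _ _ _ sU); congr Posz.
have e0 : [set e] != set0 by apply/set0Pn; exists e; rewrite set11.
rewrite -(@card_partition_block _ _ _ (no_singleton_in U)) ?sub1set ?inE //.
apply: eq_card => P; rewrite !inE; congr andb.
apply/existsP/andP => [[i /andP[/eqP ia /andP[iP /forallP nP]]]|[eP /forall_inP nP]].
  have ie : i = e by apply: val_inj.
  rewrite -ie iP; split=> //; apply/forall_inP => j; rewrite !inE => lt_aj.
  by rewrite negb_and (implyP (nP j)) ?orbT // ia.
exists e; rewrite eqxx /largest_singleton eP; apply/forallP => j.
apply/implyP => /= lt_aj; have := nP j; rewrite !inE lt_aj (inj_eq set1_inj).
by case: eqVneq lt_aj => [->|_ _ /(_ isT)//]; rewrite ltnn.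
Qed.

(** * Binomial expansion of the shifted polynomials *)

Theorem theorem3p9 (n m k : nat) :
  [/\ \sum_(0 <= j < m.+1) stirling1 m j * (A (n + k + j) (k + j))%:Z =
      \sum_(0 <= i < k.+1) \sum_(0 <= r < n.+1)
        'C(k, i)%:Z * 'C(n, r)%:Z * m%:Z ^+ (n + k - i - r) * (A (r + i) i)%:Z,
      \sum_(0 <= j < m.+1) stirling1 m j * (A (n + k + j) (k + j))%:Z =
      \sum_(0 <= i < k.+1) \sum_(0 <= r < n.+1)
        'C(k, i)%:Z * 'C(n, r)%:Z * m%:Z ^+ (k - i) * (m%:Z - 1) ^+ (n - r)
          * (bell (r + i))%:Z
    & \sum_(0 <= j < m.+1) stirling1 m j * (A (n + k + j + 1) (n + 1))%:Z =
      \sum_(0 <= i < k.+1) \sum_(0 <= r < n.+1)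
        'C(k, i)%:Z * 'C(n, r)%:Z * m%:Z ^+ (k - i) * (m%:Z + 1) ^+ (n - r)
          * (bell (r + i))%:Z].
Proof.
have expand (p q : {poly int}) (c d : int) :
    bell_eval ((p + c%:P) ^+ k * (q + d%:P) ^+ n) =
    \sum_(0 <= i < k.+1) \sum_(0 <= r < n.+1)
      'C(k, i)%:Z * 'C(n, r)%:Z * c ^+ (k - i) * d ^+ (n - r)
        * bell_eval (p ^+ i * q ^+ r).
  rewrite (addrC p) (addrC q) !exprDn mulr_suml linear_sum big_mkord /=.
  apply: eq_bigr => i _; rewrite mulr_sumr linear_sum big_mkord /=.
  apply: eq_bigr => r _; rewrite -linearZ /=; congr bell_eval.
  rewrite mulrnAr mulrnAl -mulrnA -mulr_natr natrM.
  rewrite -mul_polyC !polyCM !polyC_exp.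
  rewrite -(natz 'C(k, i)) -(natz 'C(n, r)) !polyC_natr.
  by ring.
have lhs : \sum_(0 <= j < m.+1) stirling1 m j * (A (n + k + j) (k + j))%:Z =
    bell_eval (('X + (m%:Z)%:P) ^+ k * ('X - 1 + (m%:Z)%:P) ^+ n).
  (* Here [j] occurs only in the exponent of ['X^(k + j)], so the Stirling sum yields [falling m] in
     ['X] itself. *)
  transitivity (bell_eval (falling m * ('X^k * ('X - 1) ^+ n))).
    rewrite -[falling m]comp_polyXr -sum_stirling1_bell_eval.
    apply: eq_bigr => j _; rewrite -addnA A_bell_eval exprD mulrA.
    by rewrite ['X^k * _]mulrC.
  rewrite bell_eval_falling comp_polyM !rmorphXn /= comp_polyB comp_polyX.
  by rewrite comp_polyC [_ + _ - _]addrAC.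
split.
- rewrite lhs expand; apply: eq_big_nat => i /andP[_ ltik].
  apply: eq_big_nat => r /andP[_ ltrn].
  (* Since [i <= k] and [r <= n], the truncated exponent [n + k - i - r] splits as
     [(n - r) + (k - i)]. *)
  rewrite A_bell_eval -addnBA // -addnBAC // exprD.
  by ring.
(* Reading ['X - 1 + m] as ['X + (m - 1)] leaves only powers of ['X], hence Bell numbers. *)
- rewrite lhs -addrA [- 1 + _]addrC -polyC1 -polyCB expand.
  by apply: eq_bigr => i _; apply: eq_bigr => r _; rewrite -exprD bell_evalXn addnC.
(* Now [j] sits in the exponent of ['X - 1]. The extra ['X] from [n + 1] shifts everything by 1,
   which restores [falling m] and gives [('X + 1) ^+ n * 'X^k]; the shift by [m] follows. *)
- transitivity (bell_eval ('X * ((falling m \Po ('X - 1)) * ('X^n * ('X - 1) ^+ k)))).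
    rewrite mulrCA -sum_stirling1_bell_eval; apply: eq_bigr => j _.
    rewrite (_ : n + k + j + 1 = (k + j) + (n + 1))%N; last by lia.
    by rewrite A_bell_eval; congr (_ * bell_eval _); rewrite !exprD expr1; ring.
  rewrite bell_eval_mulX comp_polyM -comp_polyA comp_polyB comp_polyX comp_polyC.
  rewrite addrK comp_polyXr bell_eval_falling !comp_polyM !rmorphXn /=.
  rewrite comp_polyB !comp_polyX comp_polyC addrK comp_polyD !comp_polyX comp_polyC.
  rewrite -addrA -polyCD mulrC expand.
  by apply: eq_bigr => i _; apply: eq_bigr => r _; rewrite -exprD bell_evalXn addnC.
Qed.
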